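(* For MLAPD on any rooted tree of depth $D$, the online algorithm \textsc{Waterfall} is $D$-competitive: on every instance, the total cost of its schedule is at most $D$ times the cost of an optimal schedule.
   Context: MLAPD: an instance is a rooted tree $\mathcal{T}$ with root $r$ and positive node costs $c(v)>0$, together with a set of requests $\rho=(v,a,d)$ issued at node $v$ with arrival time $a$ and deadline $d\ge a$ (deadlines distinct). A service $(S,t)$ is a subtree $S\ni r$ of $\mathcal{T}$ transmitted at time $t$, costing $c(S)=\sum_{u\in S}c(u)$; it satisfies $(v,a,d)$ if $v\in S$ and $a\le t\le d$. A feasible schedule satisfies every request; its cost is the sum of its service costs. Online: requests are revealed at arrival; the tree is known. Depth $D$: maximum number of nodes on a root-to-leaf path. $c$-competitive: cost at most $c$ times optimal on every instance. $\mathcal{T}_v$ is the subtree rooted at $v$. A request is pending at time $t$ if it has arrived by $t$ and was not satisfied by earlier transmissions. For a pending request $\rho$ in $\mathcal{T}_v$, $P(v\to\rho)$ is the node set of the path from $v$ to the node of $\rho$, $P_\rho=P(r\to\rho)$, and for a node set $S$, $P(v\to\rho\mid S)=P(v\to\rho)\setminus S$. \textsc{Waterfall}: every node $u$ carries a price $p(u)$, initialized to $c(u)$; write $p(X)=\sum_{u\in X}p(u)$. When a pending request $\rho$ reaches its deadline $t=d_\rho$: set $S=P_\rho$ and $p(v)=c(v)$ for $v\in P_\rho$; put the nodes of $P_\rho$ into a FIFO queue $Q$; while $Q\ne\emptyset$, dequeue a node $v$, run the $v$-fall on $S$ and enqueue every node it returns; finally transmit $(S,t)$. The $v$-fall: set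 $A=\emptyset$ and budget $b=c(v)$; go through the pending requests $\gamma$ in $\mathcal{T}_v$ in increasing order of deadline; for each, let $P=P(v\to\gamma\mid S)$ with the current $S$; if $p(P)>b$, replace $p(u)$ by $p(u)(1-b/p(P))$ for every $u\in P$ and stop; otherwise add $P$ to $A$ and to $S$, set $b\gets b-p(P)$, and reset $p(u)=c(u)$ for all $u\in P$. The $v$-fall returns $A$. *)

(* Defs.v *)
From HB Require Import structures.
From mathcomp Require Import all_boot all_order all_algebra.
Set Implicit Arguments. Unset Strict Implicit. Unset Printing Implicit Defensive.
Import Order.TTheory GRing.Theory Num.Theory.
Local Open Scope ring_scope.

Section MLAPD.
Variable R : realFieldType.
Variable V : finType.
Variable r : V.
Variable par : V -> V.

(* A rooted tree: the root is its own parent and every node reaches the root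
   by iterating the parent map (this rules out cycles). *)
Definition is_rooted_tree : Prop :=
  par r = r /\ forall v : V, exists n : nat, iter n par v = r.

Definition anc (u v : V) : bool := [exists n : 'I_#|V|, iter n par v == u].

(* node set of the path from u down to w (empty if w not in T_u) *)
Definition path_set (u w : V) : {set V} := [set x | anc u x && anc x w].
Definition root_path (v : V) : {set V} := [set x | anc x v].

Definition leaf (v : V) : bool := [forall w, (par w == v) ==> (w == v)].
Definition depth : nat := \max_(v | leaf v) #|root_path v|.

Definition request := (V * R * R)%type.
Definition rnode (q : request) : V := q.1.1.
Definition rarr (q : request) : R := q.1.2.
Definition rdead (q : request) : R := q.2.

(* Services: (subtree, time) *)
Definition service := ({set V} * R)%type.
Definition is_subtree (S : {set V}) : bool :=
  (r \in S) && [forall u in S, par u \in S].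
Definition satisfies (s : service) (q : request) : bool :=
  (rnode q \in s.1) && (rarr q <= s.2 <= rdead q).

Variable c : V -> R.

Definition set_cost (f : V -> R) (S : {set V}) : R := \sum_(u in S) f u.
Definition sched_cost (sched : seq service) : R :=
  \sum_(s <- sched) set_cost c s.1.

Definition feasible (reqs : seq request) (sched : seq service) : Prop :=
  (forall s, s \in sched -> is_subtree s.1) /\
  (forall q, q \in reqs -> has (fun s => satisfies s q) sched).

(* pending at time t w.r.t. the transmissions made so far (all earlier) *)
Definition pending (trans : seq service) (t : R) (q : request) : bool :=
  (rarr q <= t) && ~~ has (fun s => satisfies s q) trans.

Fixpoint vfall_loop (v : V) (l : seq request) (S : {set V}) (p : V -> R)
    (b : R) (A : {set V}) : {set V} * (V -> R) * {set V} :=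
  match l with
  | [::] => (S, p, A)
  | g :: l' =>
      let P := path_set v (rnode g) :\: S in
      let pP := set_cost p P in
      if b < pP then
        (S, (fun u => if u \in P then p u * (1 - b / pP) else p u), A)
      else
        vfall_loop v l' (S :|: P) (fun u => if u \in P then c u else p u)
          (b - pP) (A :|: P)
  end.

(* the v-fall on S; pend = pending requests sorted by increasing deadline.
   Returns (new S, new prices, A). *)
Definition vfall (pend : seq request) (v : V) (S : {set V}) (p : V -> R) :=
  vfall_loop v [seq g <- pend | anc v (rnode g)] S p (c v) set0.

Variable enq : {set V} -> seq V.  (* order in which a returned set is enqueued *)

(* FIFO queue processing; each node is enqueued at most once, so #|V|
   dequeue steps suffice. *)
Fixpoint queue_loop (pend : seq request) (n : nat) (Q : seq V) (S : {set V})
    (p : V -> R) : {set V} * (V -> R) :=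
  match n with
  | 0 => (S, p)
  | n'.+1 =>
      match Q with
      | [::] => (S, p)
      | v :: Q' =>
          let '(S1, p1, A1) := vfall pend v S p in
          queue_loop pend n' (Q' ++ enq A1) S1 p1
      end
  end.

Definition wf_step (sorted_reqs : seq request)
    (st : seq service * (V -> R)) (rho : request) : seq service * (V -> R) :=
  let '(trans, p) := st in
  let t := rdead rho in
  if pending trans t rho then
    let pend := [seq g <- sorted_reqs | pending trans t g] in
    let P := root_path (rnode rho) in
    let p0 := fun u => if u \in P then c u else p u in
    let '(S1, p1) := queue_loop pend #|V| (enq P) P p0 in
    (rcons trans (S1, t), p1)
  else (trans, p).

Definition waterfall (reqs : seq request) : seq service :=
  let sreqs := sort (fun x y : request => rdead x <= rdead y) reqs in
  (foldl (wf_step sreqs) ([::], c) sreqs).1.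

End MLAPD.

(* Main.v *)
Require Import Defs.
From HB Require Import structures.
From mathcomp Require Import all_boot all_order all_algebra.
From mathcomp Require Import zify ring lra.
Import Order.TTheory GRing.Theory Num.Theory.
Set Implicit Arguments. Unset Strict Implicit. Unset Printing Implicit Defensive.
Local Open Scope ring_scope.

(** Call a pair (j, v) an item if v belongs to the j-th Waterfall service; the
item lasts until the next service of v. The v-fall of service j invests at most
c(v) in strict descendants of v, each share going to the item of the descendant
that is current at that moment; an item (j, w) receives at most c(w), and exactly
c(w) if it ends with a service for which w is not on the path of the triggering
request. An item is good if the reference schedule serves v while the item lasts.
It is down if it is not good, its fall exhausted the budget, and the reference
schedule does not serve v between the fall and the deadline at which the fall
stopped. It is up if it has an end and is neither good nor down.

A request that is pending at a service was either absent from the previous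
service of a node above it, or made the fall of that node stop. Hence down items
invest only in good or down items, up items receive only from good or up items,
and an item that ends on the path of a triggering request is good or down. So
down items send out all of their cost and up items are paid in full.
Weighting costs by the depth d(v) (resp. by D - d(v) + 1), which increases (resp.
decreases) along investments, the down items cost in total at most the sum of
(d(v) - 1) c(v) over the good items, and the up items at most the sum of
(D - d(v)) c(v). The total cost is thus at most D times the cost of the good
items, and distinct good items of v are charged to distinct services of v in the
reference schedule. *)

(** * Ancestry and depth in the rooted tree *)

Section Tree.
Variables (V : finType) (r : V) (par : V -> V).

Lemma anc_fconnect u v : anc par u v = fconnect par v u.
Proof.
apply/existsP/idP => [[n /eqP<-]|]; first exact: fconnect_iter.
move=> uv; have lt : (findex par v u < #|V|)%N.
  exact: leq_trans (findex_max uv) (max_card _).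
by exists (Ordinal lt); rewrite /= iter_findex.
Qed.

Lemma anc_refl v : anc par v v.
Proof. by rewrite anc_fconnect connect0. Qed.

Lemma anc_trans v u w : anc par u v -> anc par v w -> anc par u w.
Proof. by rewrite !anc_fconnect => uv vw; apply: connect_trans vw uv. Qed.

Hypothesis tree : is_rooted_tree r par.

(** A cycle through [u] and [v] makes [v] periodic under [par]. A large enough multiple of the
    period passes through [r], which is a fixed point, so the cycle collapses to [r]. *)
Lemma anc_antisym u v : anc par u v -> anc par v u -> u = v.
Proof.
case: tree => rr reach; rewrite !anc_fconnect => /iter_findex uE /iter_findex vE.
set a := findex par v u in uE; set b := findex par u v in vE.
have rfix k : iter k par r = r by elim: k => //= k ->.
have [n nr] := reach v.
have vper k : iter (k * (b + a)) par v = v.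
  by elim: k => // k IHk; rewrite mulSn iterD IHk iterD uE vE.
have [ab0|ab0] := eqVneq (b + a)%N 0%N.
  by move: uE; rewrite (_ : a = 0%N) //; lia.
have vr : v = r.
  have le : (n <= n * (b + a))%N by rewrite leq_pmulr // lt0n.
  by rewrite -(vper n) -(subnK le) iterD nr rfix.
by rewrite -uE vr rfix.
Qed.

Lemma root_path_card_lt u v : anc par u v -> u != v ->
  (#|root_path par u| < #|root_path par v|)%N.
Proof.
move=> uv neq; apply: proper_card; apply/properP; split.
  by apply/subsetP => z; rewrite !inE => zu; apply: anc_trans zu uv.
exists v; rewrite inE ?anc_refl //.
by apply: contraNN neq => vu; rewrite (anc_antisym uv vu).
Qed.

Lemma root_path_card_gt0 v : (0 < #|root_path par v|)%N.
Proof. by apply/card_gt0P; exists v; rewrite inE anc_refl. Qed.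

(** [depth] ranges over leaves only, but a node with a longest root path is a leaf: a child would
    have a longer one. *)
Lemma root_path_card_le_depth v : (#|root_path par v| <= depth par)%N.
Proof.
pose u := [arg max_(u > v) #|root_path par u|].
have uP w : (#|root_path par w| <= #|root_path par u|)%N.
  by rewrite /u; case: arg_maxnP => // i _; apply.
apply: leq_trans (uP v) _.
apply: (@leq_bigmax_cond _ _ (fun v => #|root_path par v|)).
apply/forallP => w; apply/implyP => /eqP wu; apply: contraT => neq.
have uw : anc par u w by rewrite anc_fconnect -wu fconnect1.
by have := root_path_card_lt uw; rewrite eq_sym neq ltnNge uP => /(_ isT).
Qed.

Lemma subtree_anc (X : {set V}) v w :
  is_subtree r par X -> w \in X -> anc par v w -> v \in X.
Proof.
case/andP=> _ /forall_inP parX wX; rewrite anc_fconnect => /iter_findex <-.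
by elim: findex => //= n IHn; apply: parX.
Qed.

End Tree.

(** * Weighted accounting of investments over abstract items *)

Section Accounting.
Variables (R : realFieldType) (V : finType) (c : V -> R) (S : nat -> {set V}).

(** Picks the item of [w] that is current after service [n]. The default 0 is a genuine item because
    service 0 contains every node. *)
Fixpoint last_service (n : nat) (w : V) : nat :=
  match n with
  | 0 => 0
  | n'.+1 => if w \in S n'.+1 then n'.+1 else last_service n' w
  end.

Lemma last_service_le n w : (last_service n w <= n)%N.
Proof. by elim: n => //= n IHn; case: ifP => // _; apply: leqW. Qed.

Lemma last_service_max n w j :
  w \in S j -> (j <= n)%N -> (j <= last_service n w)%N.
Proof.
move=> wj; elim: n => [|n IHn] /=; first by rewrite leqn0 => /eqP->.
case: ifPn => // wn; rewrite leq_eqVlt => /orP[/eqP jn|]; last exact: IHn.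
by rewrite -jn wj in wn.
Qed.

Hypothesis S0 : S 0 = [set: V].

Lemma last_service_mem n w : w \in S (last_service n w).
Proof. by elim: n => [|n IHn] /=; [rewrite S0 inE | case: ifP]. Qed.

Variables (m : nat) (p : nat -> V -> R) (crit : nat -> {set V}).
Variable x : nat -> V -> V -> R.
Hypothesis c_ge0 : forall v, 0 <= c v.
Hypothesis p_ge0 : forall j w, (j <= m)%N -> 0 <= p j w.
Hypothesis p_served : forall j w, (j <= m)%N -> w \in S j -> p j w = c w.
Hypothesis in_unserved : forall i w, (i < m)%N -> w \notin S i.+1 ->
  \sum_v x i.+1 v w = p i w - p i.+1 w.
Hypothesis in_served : forall i w, (i < m)%N -> w \in S i.+1 ->
  w \notin crit i.+1 -> \sum_v x i.+1 v w = p i w.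
Hypothesis in_crit : forall i w, (i < m)%N -> w \in S i.+1 ->
  w \in crit i.+1 -> \sum_v x i.+1 v w = 0.

(** The price of [w] starts each item at [c w] and falls by what the item receives, so the sum
    telescopes. The extra term is the price still unpaid on the current item. A service with [w] in
    [crit] resets the price without payment, hence the condition that [g] vanishes on the item ended
    there. *)
Lemma in_weight_eq (g : nat -> V -> R) w n : (n <= m)%N ->
  (forall i, (i < n)%N -> w \in S i.+1 -> w \in crit i.+1 ->
     g (last_service i w) w = 0) ->
  \sum_(i < n) g (last_service i w) w * (\sum_v x i.+1 v w)
    + g (last_service n w) w * p n w
  = \sum_(j < n.+1) (w \in S j)%:R * g j w * c w.
Proof.
elim: n => [|n IHn] nm g0.
  by rewrite big_ord0 big_ord1 /= add0r S0 inE mul1r p_served // S0 inE.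
rewrite big_ord_recr [RHS]big_ord_recr /= -IHn; first last.
- by move=> i /leqW; apply: g0.
- exact: ltnW.
have [wS|wS] := boolP (w \in S n.+1); last by rewrite in_unserved // !mul0r; ring.
rewrite (p_served nm wS); case: (boolP (w \in crit n.+1)) => wc.
  by rewrite g0 // mul1r; ring.
by rewrite in_served // mul1r; ring.
Qed.

(** The same telescoping; a reset at a [crit] node only forfeits a nonnegative remainder. *)
Lemma in_weight_le (g : nat -> V -> R) w n : (n <= m)%N ->
  (forall j, 0 <= g j w) ->
  \sum_(i < n) g (last_service i w) w * (\sum_v x i.+1 v w)
    + g (last_service n w) w * p n w
  <= \sum_(j < n.+1) (w \in S j)%:R * g j w * c w.
Proof.
move=> + g_ge0; elim: n => [|n IHn] nm.
  by rewrite big_ord0 big_ord1 /= add0r S0 inE mul1r p_served // S0 inE.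
rewrite big_ord_recr [leRHS]big_ord_recr /=.
apply: le_trans (lerD (IHn (ltnW nm)) (lexx _)).
have [wS|wS] := boolP (w \in S n.+1); last by rewrite in_unserved // !mul0r; lra.
rewrite (p_served nm wS); case: (boolP (w \in crit n.+1)) => wc.
  rewrite in_crit // mulr0 addr0 mul1r lerD2r lerDl.
  by apply: mulr_ge0; [exact: g_ge0 | apply: p_ge0; apply: ltnW].
by rewrite in_served // mul1r; lra.
Qed.

Variables (dep : V -> nat) (D : nat).
Hypothesis dep_gt0 : forall v, (0 < dep v)%N.
Hypothesis dep_le : forall v, (dep v <= D)%N.
Hypothesis x_ge0 : forall i v w, (i < m)%N -> 0 <= x i.+1 v w.
Hypothesis x_support : forall i v w, (i < m)%N -> x i.+1 v w != 0 ->
  v \in S i.+1 /\ (dep v < dep w)%N.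
Hypothesis out_le : forall i v, (i < m)%N -> \sum_w x i.+1 v w <= c v.

Variables (good down : nat -> V -> bool).
Let up j w := [&& ~~ good j w, ~~ down j w & j != last_service m w].

Hypothesis down_good : forall j v, down j v -> ~~ good j v.
Hypothesis down0 : forall v, ~~ down 0 v.
Hypothesis down_out : forall i v, (i < m)%N -> v \in S i.+1 -> down i.+1 v ->
  \sum_w x i.+1 v w = c v.
Hypothesis down_edge : forall i v w, (i < m)%N -> down i.+1 v ->
  x i.+1 v w != 0 ->
  good (last_service i w) w || down (last_service i w) w.
Hypothesis up_edge : forall i v w, (i < m)%N -> x i.+1 v w != 0 ->
  up (last_service i w) w -> good i.+1 v || up i.+1 v.
Hypothesis crit_class : forall i w, (i < m)%N -> w \in crit i.+1 ->
  good (last_service i w) w || down (last_service i w) w.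

Let items (g : nat -> V -> R) : R :=
  \sum_(j < m.+1) \sum_w (w \in S j)%:R * g j w * c w.

Let items_exchange g :
  items g = \sum_w \sum_(j < m.+1) (w \in S j)%:R * g j w * c w.
Proof. exact: exchange_big. Qed.

Lemma x_row0 i v : (i < m)%N -> v \notin S i.+1 -> forall w, x i.+1 v w = 0.
Proof. by move=> im vS w; apply: contraNeq vS => /(x_support im)[]. Qed.

(** A down item sends its whole cost to good or down items at least one level deeper, so weight
    [dep] at the source is covered by [dep - 1] at the target. What the targets receive is at most
    their cost. *)
Lemma down_weight_le :
  items (fun j w => (down j w)%:R * (dep w)%:R)
  <= items (fun j w => (good j w || down j w)%:R * ((dep w)%:R - 1)).
Proof.
set g := fun j w => (good j w || down j w)%:R * ((dep w)%:R - 1).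
have dep1 w : 0 <= (dep w)%:R - 1 :> R by rewrite subr_ge0 ler1n.
rewrite {1}/items big_ord_recl big1 ?add0r; last first.
  by move=> w _; rewrite (negbTE (down0 w)) mul0r mulr0 mul0r.
rewrite items_exchange.
have step w := in_weight_le (g := g) (w := w) (leqnn m).
apply: (@le_trans _ _ (\sum_w \sum_(i < m)
   g (last_service i w) w * (\sum_v x i.+1 v w))); last first.
  apply: ler_sum => w _; apply: le_trans (step w _); last first.
    by move=> j; rewrite mulr_ge0.
  by rewrite lerDl mulr_ge0 ?p_ge0 // mulr_ge0.
rewrite [leRHS]exchange_big /=; apply: ler_sum => i _.
rewrite [bump 0 i]add1n.
under [leRHS]eq_bigr do rewrite mulr_sumr.
rewrite exchange_big /=; apply: ler_sum => v _.
have [vS|vS] := boolP (v \in S i.+1); last first.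
  rewrite !mul0r; apply: sumr_ge0 => w _.
  by rewrite (x_row0 _ vS) // mulr0.
have [dv|dv] := boolP (down i.+1 v); last first.
  rewrite mul0r mulr0 mul0r; apply: sumr_ge0 => w _.
  by rewrite !mulr_ge0 // x_ge0.
rewrite !mul1r -(down_out _ vS dv) // mulr_sumr; apply: ler_sum => w _.
have [->|xn0] := eqVneq (x i.+1 v w) 0; first by rewrite !mulr0.
rewrite /g (down_edge _ dv xn0) // mul1r ler_wpM2r ?x_ge0 //.
have [_ lt] := x_support (ltn_ord i) xn0.
by rewrite lerBrDr natr1 ler_nat.
Qed.

(** The mirror image: an up item receives exactly its cost, from good or up items at least one level
    higher, and those send at most their cost. *)
Lemma up_weight_le :
  items (fun j w => (up j w)%:R * (D%:R - (dep w)%:R + 1))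
  <= items (fun j w => (good j w || up j w)%:R * (D%:R - (dep w)%:R)).
Proof.
set g := fun j w => (up j w)%:R * (D%:R - (dep w)%:R + 1).
have h0 w : 0 <= D%:R - (dep w)%:R :> R by rewrite subr_ge0 ler_nat.
rewrite items_exchange.
rewrite [leRHS]/items big_ord_recl /=.
apply: ler_wpDl.
  by apply: sumr_ge0 => w _; rewrite !mulr_ge0.
under eq_bigr => w _.
  rewrite -(in_weight_eq (g := g)) //; last first.
    move=> i im wS wc; rewrite /g /up.
    have := crit_class im wc.
    by case: good => //=; case: down => //=; rewrite mul0r.
  rewrite {2}/g /up eqxx !andbF !mul0r addr0.
  over.
rewrite exchange_big /=; apply: ler_sum => i _.
rewrite [bump 0 i]add1n.
under eq_bigr do rewrite mulr_sumr.
rewrite exchange_big /=; apply: ler_sum => v _.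
have [vS|vS] := boolP (v \in S i.+1); last first.
  rewrite !mul0r big1 // => w _.
  by rewrite (x_row0 _ vS) // mulr0.
set a := (good i.+1 v || up i.+1 v)%:R * (D%:R - (dep v)%:R).
have a0 : 0 <= a by rewrite mulr_ge0.
rewrite mul1r; apply: le_trans (ler_wpM2l a0 (out_le v (ltn_ord i))).
rewrite mulr_sumr; apply: ler_sum => w _.
have [->|xn0] := eqVneq (x i.+1 v w) 0; first by rewrite !mulr0.
apply: ler_wpM2r; first by rewrite x_ge0.
have [_ lt] := x_support (ltn_ord i) xn0.
rewrite /g; case: (boolP (up _ w)) => [uw|_]; last by rewrite mul0r.
rewrite mul1r /a (up_edge _ xn0 uw) // mul1r.
have : (dep v)%:R + 1 <= (dep w)%:R :> R by rewrite natr1 ler_nat.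
lra.
Qed.

Lemma cost_le_good :
  \sum_(i < m) \sum_(w in S i.+1) c w
  <= D%:R * \sum_(j < m.+1) \sum_(w in S j) (good j w)%:R * c w.
Proof.
have -> : \sum_(i < m) \sum_(w in S i.+1) c w
    = items (fun j w => (j != last_service m w)%:R).
  rewrite items_exchange.
  transitivity (\sum_w \sum_(i < m) (w \in S i.+1)%:R * c w).
    rewrite exchange_big; apply: eq_bigr => i _; rewrite big_mkcond.
    by apply: eq_bigr => w _; case: ifP; rewrite ?mul1r ?mul0r.
  apply: eq_bigr => w _.
  have lw : (last_service m w < m.+1)%N by rewrite ltnS last_service_le.
  (* Each side lacks one copy of [c w]: the left omits the fictitious service 0, the right omits the
     item of [w] that has no end. *)
  apply: (@addrI _ (c w)).
  transitivity (\sum_(j < m.+1) (w \in S j)%:R * c w).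
    rewrite [RHS]big_ord_recl /= S0 inE mul1r; congr (_ + _).
  rewrite (bigD1 (Ordinal lw)) //= last_service_mem mul1r; congr (_ + _).
  rewrite [RHS](bigD1 (Ordinal lw)) //= eqxx mulr0 mul0r add0r.
  by apply: eq_bigr => j; rewrite -val_eqE /= => ->; rewrite mulr1.
have -> : \sum_(j < m.+1) \sum_(w in S j) (good j w)%:R * c w
    = items (fun j w => (good j w)%:R).
  apply: eq_bigr => j _; rewrite big_mkcond; apply: eq_bigr => w _.
  by case: ifP; rewrite ?mul1r ?mul0r.
(* Compare item by item: down and up items keep a net weight of 1, while a good item gets
   [(dep - 1) + (D - dep) = D - 1], leaving 1 for its own cost. *)
have := lerD down_weight_le up_weight_le.
rewrite -subr_ge0 => H; rewrite -subr_ge0; apply: le_trans H _.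
rewrite /items mulr_sumr -!big_split -!sumrB /=; apply: ler_sum => j _.
rewrite mulr_sumr -!big_split -!sumrB /=; apply: ler_sum => w _.
have := c_ge0 w; rewrite /up; have := @down_good j w.
case: (w \in S j); last by move=> *; rewrite !mul0r !(mulr0, addr0, subr0).
by case: (good j w); case: (down j w); case: (nat_of_ord j == last_service m w) => //= dg cw;
  try (by have := dg isT); rewrite ?(mul1r, mul0r, mulr0); lra.
Qed.

End Accounting.

(** * Invariants of one fall and of one whole service *)

Section Falls.
Variables (R : realFieldType) (V : finType) (par : V -> V).
Variables (c : V -> R) (enq : {set V} -> seq V).
Hypothesis c_gt0 : forall v, 0 < c v.

(* A node bought by the fall (in S1 but not in S) has paid all of its price;
   its new price p1 is the one already reset to its cost. *)
Definition investment (S S1 : {set V}) (p p1 : V -> R) (w : V) : R :=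
  p w - (if w \in S1 :\: S then 0 else p1 w).

Definition by_deadline (q q' : request R V) := rdead q <= rdead q'.

(* ov: the fall stopped because its budget was exhausted; h: a bound on the
   deadlines of the requests that the fall considered. *)
Record fall_spec (v : V) (l : seq (request R V)) (S : {set V}) (p : V -> R)
    (b : R) (S1 : {set V}) (p1 : V -> R) (ov : bool) (h : R) : Prop := {
  fall_sub : S \subset S1;
  fall_served : forall w, w \in S1 :\: S -> p1 w = c w;
  fall_old : forall w, w \in S -> p1 w = p w;
  fall_price_ge0 : forall w, 0 <= p1 w;
  fall_inv_ge0 : forall w, 0 <= investment S S1 p p1 w;
  fall_inv_le : \sum_w investment S S1 p p1 w <= b;
  fall_inv_ov : ov -> \sum_w investment S S1 p p1 w = b;
  fall_inv_support : forall w, investment S S1 p p1 w != 0 ->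
    exists2 q, q \in l & [/\ w \notin S, anc par v w, anc par w (rnode q)
                          & rdead q <= h];
  fall_unserved : forall q, q \in l -> rnode q \notin S1 ->
    ov /\ h <= rdead q }.

(** After buying [P], the rest is a fall on [S :|: P] with the remaining budget. Since [l] is
    sorted, the request that stops the fall has the least deadline among those left over, and this
    deadline serves as [h]. *)
Lemma vfall_loop_spec v l S p b A :
  sorted by_deadline l -> (forall q, q \in l -> anc par v (rnode q)) ->
  (forall w, 0 <= p w) -> 0 <= b ->
  let: (S1, p1, A1) := vfall_loop par c v l S p b A in
  A1 = A :|: (S1 :\: S) /\ exists ov h, fall_spec v l S p b S1 p1 ov h.
Proof.
elim: l S p b A => [|q l IHl] S p b A lsort lanc p0 b0 /=.
  split; first by rewrite setDv setU0.
  have inv0 w : investment S S p p w = 0.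
    by rewrite /investment setDv inE subrr.
  (* The horizon 0 is arbitrary: nothing was invested. *)
  exists false, 0; split => //.
  - by move=> w; rewrite setDv inE.
  - by move=> w; rewrite inv0.
  - by rewrite big1.
  - by move=> w; rewrite inv0 eqxx.
set P := path_set par v (rnode q) :\: S; set a := set_cost p P.
have PP w : w \in P -> [/\ w \notin S, anc par v w & anc par w (rnode q)].
  by rewrite !inE => /and3P[].
have qmin q' : q' \in l -> rdead q <= rdead q'.
  have tr : transitive by_deadline by move=> y x z; apply: le_trans.
  by have /allP := order_path_min tr lsort; apply.
(* Overflow: the budget is split over [P] in proportion to the prices, so the shares add up to
   exactly [b]. *)
case: ifPn => [ba|ba].
  split; first by rewrite setDv setU0.
  have a0 : 0 < a by apply: le_lt_trans ba.
  pose p1 u := if u \in P then p u * (1 - b / a) else p u.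
  have inv w : investment S S p p1 w = (w \in P)%:R * (p w * (b / a)).
    rewrite /investment setDv inE /p1; case: ifP => _; last by rewrite mul0r subrr.
    by rewrite mul1r; ring.
  have ba0 : 0 <= b / a by rewrite divr_ge0 // ltW.
  have suminv : \sum_w investment S S p p1 w = b.
    under eq_bigr do rewrite inv.
    transitivity (a * (b / a)); last by rewrite mulrC divfK // gt_eqF.
    rewrite /a /set_cost mulr_suml [RHS]big_mkcond; apply: eq_bigr => w _.
    by case: ifP => _; rewrite ?mul1r ?mul0r.
  exists true, (rdead q); rewrite -/p1; split => //.
  - by move=> w; rewrite setDv inE.
  - by move=> w wS; rewrite /p1; case: ifP => // /PP[]; rewrite wS.
  - move=> w; rewrite /p1; case: ifP => // _; rewrite mulr_ge0 // subr_ge0.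
    by rewrite ler_pdivrMr // mul1r ltW.
  - by move=> w; rewrite inv mulr_ge0 // mulr_ge0.
  - by rewrite suminv.
  - move=> w; rewrite inv; case: (boolP (w \in P)) => [/PP[? ? ?] _|_].
      by exists q; rewrite ?mem_head.
    by rewrite mul0r eqxx.
  - move=> q'; rewrite inE => /predU1P[->//|ql] _; split => //.
    exact: qmin.
rewrite -leNgt in ba.
pose p' u := if u \in P then c u else p u; pose b' := b - a; rewrite -/p' -/b'.
have lsort' : sorted by_deadline l by apply: path_sorted lsort.
have := IHl (S :|: P) p' b' (A :|: P) lsort'.
case: vfall_loop => [[S1 p1] A1] /(_ _ _ _)[].
- by move=> q' q'l; apply: lanc; rewrite inE q'l orbT.
- by move=> w; rewrite /p'; case: ifP => // _; apply: ltW.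
- by rewrite subr_ge0.
move=> -> [ov [h [sub1 served1 old1 price1 ge1 le1 ov1 supp1 uns1]]].
have SS1 : S \subset S1 by apply: subset_trans sub1; apply: subsetUl.
have PS1 : P \subset S1 by apply: subset_trans sub1; apply: subsetUr.
have PS w : w \in P -> w \notin S by case/PP.
have diff w : w \in S1 :\: S = (w \in P) || (w \in S1 :\: (S :|: P)).
  rewrite in_setD [in RHS]in_setD in_setU negb_or.
  have [wP|wP] := boolP (w \in P); last by rewrite andbT.
  by rewrite (PS _ wP) (subsetP PS1).
(* A node of [P] pays its full price now and nothing later, as the later loop leaves prices on
   [S :|: P] alone. *)
have inv w : investment S S1 p p1 w =
    (w \in P)%:R * p w + investment (S :|: P) S1 p' p1 w.
  rewrite /investment diff; have [wP|wP] := boolP (w \in P).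
    rewrite in_setD in_setU wP orbT /= old1 ?in_setU ?wP ?orbT //.
    by rewrite mul1r subrr addr0 subr0.
  by rewrite mul0r add0r /= /p' (negbTE wP).
have suminv : \sum_w investment S S1 p p1 w =
    a + \sum_w investment (S :|: P) S1 p' p1 w.
  under eq_bigr do rewrite inv.
  rewrite big_split /=; congr (_ + _); rewrite /a /set_cost [RHS]big_mkcond.
  by apply: eq_bigr => w _; case: ifP => _; rewrite ?mul1r ?mul0r.
split.
  by rewrite -setUA; congr (_ :|: _); apply/setP => w; rewrite in_setU diff.
exists ov, (Num.max h (rdead q)); split => //.
- move=> w; rewrite diff => /orP[wP|/served1//].
  by rewrite old1 ?in_setU ?wP ?orbT // /p' wP.
- move=> w wS; rewrite old1 ?in_setU ?wS // /p'.
  by case: ifP => // /PS; rewrite wS.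
- by move=> w; rewrite inv addr_ge0 // mulr_ge0.
- by rewrite suminv; move: le1; rewrite /b'; lra.
- by rewrite suminv => /ov1 ->; rewrite /b'; ring.
- move=> w; rewrite inv; have [wP _|wP] := boolP (w \in P).
    have [? ? ?] := PP _ wP; exists q; first exact: mem_head.
    by split; rewrite // le_max lexx orbT.
  rewrite mul0r add0r => /supp1[q' q'l [wS vw wq qh]].
  exists q'; first by rewrite inE q'l orbT.
  by split; rewrite ?le_max ?qh //; apply: contraNN wS => wS; rewrite inE wS.
- move=> q'; rewrite inE => /predU1P[->|q'l] qS.
    case/negP: qS; apply: (subsetP sub1); rewrite !inE.
    by case: (_ \in S) => //=; rewrite lanc ?mem_head // anc_refl.
  by have [-> hq] := uns1 _ q'l qS; rewrite ge_max hq qmin.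
Qed.

(* Z is the queue at the start, so Z :|: (S1 :\: S) is the set of nodes whose
   fall is run. *)
Record service_spec (pend : seq (request R V)) (Z S : {set V}) (p : V -> R)
    (S1 : {set V}) (p1 : V -> R) (x : V -> V -> R) (ov : V -> bool)
    (h : V -> R) : Prop := {
  serv_sub : S \subset S1;
  serv_served : forall w, w \in S1 :\: S -> p1 w = c w;
  serv_old : forall w, w \in S -> p1 w = p w;
  serv_price_ge0 : forall w, 0 <= p1 w;
  serv_in : forall w, \sum_v x v w = investment S S1 p p1 w;
  serv_inv_ge0 : forall v w, 0 <= x v w;
  serv_out_le : forall v, \sum_w x v w <= c v;
  serv_out_ov : forall v, ov v -> \sum_w x v w = c v;
  serv_support : forall v w, x v w != 0 ->
    [/\ v \in Z :|: (S1 :\: S), anc par v w, v != w &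
        exists2 q, q \in pend & anc par w (rnode q) /\ rdead q <= h v];
  serv_unserved : forall v q, v \in Z :|: (S1 :\: S) -> q \in pend ->
    anc par v (rnode q) -> rnode q \notin S1 -> ov v /\ h v <= rdead q }.

Hypothesis enqP : forall X : {set V}, perm_eq (enq X) (enum X).

Lemma mem_enq X v : (v \in enq X) = (v \in X).
Proof. by rewrite (perm_mem (enqP X)) mem_enum. Qed.

(** The fuel suffices because a purchase only moves nodes from the complement of [S] into the queue,
    while each dequeue removes one. The queue stays duplicate-free inside [S], so each node falls at
    most once and that fall determines its row of [x]. *)
Lemma queue_loop_spec pend n (Q : seq V) (S : {set V}) (p : V -> R) :
  sorted by_deadline pend -> (forall w, 0 <= p w) ->
  uniq Q -> {subset Q <= S} -> (size Q + #|~: S| <= n)%N ->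
  let: (S1, p1) := queue_loop par c enq pend n Q S p in
  exists x ov h, service_spec pend [set v in Q] S p S1 p1 x ov h.
Proof.
move=> psort.
have base S' p' : (forall w, 0 <= p' w) ->
    exists x ov h, service_spec pend [set v in [::]] S' p' S' p' x ov h.
  move=> p'0; exists (fun _ _ => 0), (fun=> false), (fun=> 0).
  split => //.
  - by move=> w; rewrite setDv inE.
  - by move=> w; rewrite big1 // /investment setDv inE subrr.
  - by move=> v; rewrite big1 // ltW.
  - by move=> v w; rewrite eqxx.
  - by move=> v q; rewrite setDv !inE.
elim: n Q S p => [|n IHn] Q S p p0 Quniq QS /=.
  by case: Q Quniq QS => // _ _ _; apply: base.
case: Q Quniq QS => [_ _ _|v Q]; first exact: base.
rewrite cons_uniq => /andP[vQ Quniq] QS szn.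
have vS : v \in S by apply: QS; rewrite mem_head.
have fsort : sorted by_deadline [seq g <- pend | anc par v (rnode g)].
  by apply: sorted_filter psort; move=> y x z; apply: le_trans.
have := @vfall_loop_spec v _ S p (c v) set0 fsort.
rewrite /vfall; case: vfall_loop => [[S' p'] A'] /(_ _ p0 _)[].
- by move=> q; rewrite mem_filter => /andP[].
- exact: ltW.
rewrite set0U => ->{A'} [ov0 [h0 F]].
have SS' := fall_sub F.
have := IHn (Q ++ enq (S' :\: S)) S' p' (fall_price_ge0 F).
case: queue_loop => [S1 p1] /(_ _ _ _)[].
- rewrite cat_uniq Quniq (perm_uniq (enqP _)) enum_uniq andbT /=.
  apply/hasPn => w; rewrite mem_enq inE => /andP[wS _].
  by apply: contraNN wS => wQ; apply: QS; rewrite inE wQ orbT.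
- move=> w; rewrite mem_cat mem_enq inE => /orP[wQ|/andP[]//].
  by apply: (subsetP SS'); apply: QS; rewrite inE wQ orbT.
- rewrite size_cat (perm_size (enqP _)) -cardE.
  have := cardsC S; have := cardsC S'; have := cardsD S' S.
  by rewrite (setIidPr SS'); have := subset_leq_card SS'; move: szn => /=; lia.
move=> x [ov [h H]].
have SS1 := subset_trans SS' (serv_sub H).
set Z := [set v in _ ++ _] in H.
have ran u : u \in [set z in v :: Q] :|: (S1 :\: S)
    = (u == v) || (u \in Z :|: (S1 :\: S')).
  rewrite !inE mem_cat mem_enq !inE.
  have := subsetP SS' u; have := subsetP (serv_sub H) u.
  by case: (u == v) (u \in Q) (u \in S) (u \in S') (u \in S1)
    => [] [] [] [] [] //= a b; try (have := b isT); try (have := a isT).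
have vZ : v \notin Z :|: (S1 :\: S').
  by rewrite !inE mem_cat mem_enq !inE vS (negbTE vQ) (subsetP SS' _ vS).
(* The node [v] never falls again, so its empty row can be filled with the present fall. *)
have x0 w : x v w = 0.
  by apply: contraNeq vZ => /(serv_support H)[].
exists (fun u w => if u == v then investment S S' p p' w else x u w).
exists (fun u => if u == v then ov0 else ov u).
exists (fun u => if u == v then h0 else h u).
have inS1 w : w \in S' -> w \in S1 by apply: (subsetP (serv_sub H)).
split => //.
- move=> w; rewrite inE => /andP[wS wS1].
  have [wS'|wS'] := boolP (w \in S').
    by rewrite (serv_old H) // (fall_served F) // inE wS.
  by rewrite (serv_served H) // inE wS'.
- move=> w wS; rewrite (serv_old H) ?(fall_old F) //.
  exact: (subsetP SS').
- exact: serv_price_ge0 H.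
(* The column sum telescopes through [p']: a node bought now keeps its reset price, a node bought
   later pays what this fall left of its price. *)
- move=> w; rewrite (bigD1 v) //= eqxx.
  rewrite (eq_bigr (x^~ w)); last by move=> u /negbTE ->.
  have := serv_in H w; rewrite (bigD1 v) //= x0 add0r => ->.
  rewrite /investment !inE.
  have := inS1 w; have := subsetP SS' w.
  have := @fall_old _ _ _ _ _ _ _ _ _ F w.
  have := @fall_served _ _ _ _ _ _ _ _ _ F w.
  have := @serv_old _ _ _ _ _ _ _ _ _ H w; rewrite !inE.
  case: (w \in S) (w \in S') (w \in S1) => [] [] [] //= e1 e2 e3 e4 e5;
    rewrite ?(e1 isT) ?(e3 isT); try (by have := e4 isT); try (by have := e5 isT).
  all: try ring.
- move=> u w; case: ifP => _; first exact: fall_inv_ge0 F _.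
  exact: serv_inv_ge0 H _ _.
- move=> u; case: eqP => [->|_]; first exact: fall_inv_le F.
  exact: serv_out_le H _.
- move=> u; case: eqP => [->|_]; first exact: fall_inv_ov F.
  exact: serv_out_ov H _.
- move=> u w; rewrite ran; case: (eqVneq u v) => [->|uv] /=.
    move=> /(fall_inv_support F)[q]; rewrite mem_filter => /andP[_ qp].
    case=> wS vw wq qh; split=> //; last by exists q.
    by apply: contraNneq wS => <-.
  exact: serv_support H _ _.
- move=> u q; rewrite ran; case: (eqVneq u v) => [-> _|uv] /=.
    move=> qp vq qS1; apply: (fall_unserved F); first by rewrite mem_filter vq.
    by apply: contraNN qS1; apply: inS1.
  exact: serv_unserved H _ _.
Qed.

End Falls.

(** * The log of a complete run *)

Section Run.
Variables (R : realFieldType) (V : finType) (par : V -> V).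
Variables (c : V -> R) (enq : {set V} -> seq V).
Variables (reqs : seq (request R V)) (t0 : R).

Record log_entry : Type := LogEntry {
  log_set : {set V};
  log_time : R;
  log_crit : {set V};
  log_pend : seq (request R V);
  log_price : V -> R;
  log_inv : V -> V -> R;
  log_over : V -> bool;
  log_horizon : V -> R }.

Definition reset (X : {set V}) (p : V -> R) (u : V) : R :=
  if u \in X then c u else p u.

Definition satisfied (trans : seq (service R V)) (q : request R V) : bool :=
  has (fun s => satisfies s q) trans.

(* Entry 0 is a fictitious service of all nodes at a time t0 before every
   arrival; entry i.+1 describes the i-th service of the run. *)
Record trace (m : nat) (e : nat -> log_entry) (trans : seq (service R V)) :
    Prop := {
  trace_trans :
    trans = [seq (log_set (e i.+1), log_time (e i.+1)) | i <- iota 0 m];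
  trace_set0 : log_set (e 0) = [set: V];
  trace_price0 : log_price (e 0) = c;
  trace_over0 : forall v, log_over (e 0) v = false;
  trace_time0 : log_time (e 0) = t0;
  trace_time : forall i, (i < m)%N -> log_time (e i) < log_time (e i.+1);
  trace_spec : forall i, (i < m)%N -> let l := e i.+1 in
    service_spec par c (log_pend l) (log_crit l) (log_crit l)
      (reset (log_crit l) (log_price (e i))) (log_set l) (log_price l)
      (log_inv l) (log_over l) (log_horizon l);
  trace_pend : forall i q, (i < m)%N -> q \in reqs ->
    rarr q <= log_time (e i.+1) -> ~~ satisfied trans q ->
    q \in log_pend (e i.+1);
  trace_pend_sub : forall i q, (i < m)%N -> q \in log_pend (e i.+1) ->
    q \in reqs;
  trace_crit : forall i w, (i < m)%N -> w \in log_crit (e i.+1) ->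
    exists2 q, q \in log_pend (e i.+1) &
      anc par w (rnode q) /\ rdead q = log_time (e i.+1);
  trace_open : forall i j q w, (j <= i < m)%N -> q \in log_pend (e i.+1) ->
    rarr q <= log_time (e j) -> w \in log_set (e j) -> anc par w (rnode q) ->
    log_over (e j) w /\ log_horizon (e j) w <= rdead q }.

Lemma trace_time_le m e trans i j : trace m e trans -> (i <= j <= m)%N ->
  log_time (e i) <= log_time (e j).
Proof.
move=> T; elim: j => [|j IHj]; first by rewrite leqn0 => /andP[/eqP->].
case/andP; rewrite leq_eqVlt => /predU1P[->//|ij] jm.
apply: le_trans (ltW (trace_time T jm)); apply: IHj.
by rewrite -ltnS ij ltnW.
Qed.

Hypothesis c_gt0 : forall v, 0 < c v.
Hypothesis enqP : forall X : {set V}, perm_eq (enq X) (enum X).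
Hypothesis t0_lt : forall q, q \in reqs -> t0 < rarr q.
Hypothesis arr_le : forall q, q \in reqs -> rarr q <= rdead q.
Hypothesis reqs_sorted :
  sorted (fun q q' : request R V => rdead q < rdead q') reqs.

Lemma trace_price_ge0 m e trans j w : trace m e trans -> (j <= m)%N ->
  0 <= log_price (e j) w.
Proof.
move=> T; case: j => [_|j jm]; first by rewrite (trace_price0 T) ltW.
exact: serv_price_ge0 (trace_spec T jm) _.
Qed.

(** Induction over the requests in deadline order. The last two conjuncts carry it: processed
    requests are satisfied, and all transmissions so far precede the remaining deadlines. *)
Lemma run_trace done rest : reqs = done ++ rest ->
  let: (trans, p) := foldl (wf_step par c enq reqs) ([::], c) done in
  exists m e, [/\ trace m e trans, log_price (e m) = p,
    forall q, q \in done -> satisfied trans q &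
    forall q, q \in rest -> log_time (e m) < rdead q].
Proof.
elim/last_ind: done rest => [|done rho IHd] rest reqsE /=.
  exists 0%N, (fun=> LogEntry [set: V] t0 set0 [::] c (fun _ _ => 0)
    (fun=> false) (fun=> 0)); split => //= q qr.
  have qreqs : q \in reqs by rewrite reqsE.
  exact: lt_le_trans (t0_lt qreqs) (arr_le qreqs).
have rhoreqs : rho \in reqs by rewrite reqsE mem_cat mem_rcons mem_head.
have rho_rest q : q \in rest -> rdead rho < rdead q.
  have tr : transitive (fun q q' : request R V => rdead q < rdead q').
    by move=> y x z; apply: lt_trans.
  move: reqs_sorted; rewrite reqsE cat_rcons sorted_pairwise //.
  rewrite pairwise_cat pairwise_cons => /and3P[_ _ /andP[/allP H _]].
  exact: H.
have := IHd (rho :: rest); rewrite -cat_rcons foldl_rcons => /(_ reqsE).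
case: foldl => [trans p] [m [e [T pE sat time_lt]]] /=.
have rho_lt : log_time (e m) < rdead rho by apply: time_lt; rewrite mem_head.
case: ifPn => [pend_rho|npend_rho]; last first.
  exists m, e; split => //.
    move=> q; rewrite mem_rcons inE => /predU1P[->|/sat//].
    by move: npend_rho; rewrite /pending arr_le // negbK.
  by move=> q qr; apply: time_lt; rewrite inE qr orbT.
set pend := [seq g <- reqs | _].
set P := root_path par (rnode rho).
have psort : sorted (@by_deadline R V) pend.
  apply: sorted_filter; first by move=> y x z; apply: le_trans.
  by apply: sub_sorted reqs_sorted => q q'; apply: ltW.
have p0 w : 0 <= reset P p w.
  rewrite /reset; case: ifP => _; first exact: ltW.
  by rewrite -pE (trace_price_ge0 _ T).
have := @queue_loop_spec _ _ par c enq c_gt0 enqP pend #|V| (enq P) P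
  (reset P p) psort p0.
rewrite -/(reset P p).
case: queue_loop => [S1 p1] /(_ _ _ _)[].
- by rewrite (perm_uniq (enqP _)) enum_uniq.
- by move=> w; rewrite mem_enq.
- by rewrite (perm_size (enqP _)) -cardE cardsC.
move=> x [ov [h H]].
have {}H : service_spec par c pend P P (reset P p) S1 p1 x ov h.
  have eP : [set v in enq P] = P by apply/setP => w; rewrite inE mem_enq.
  by rewrite eP in H.
set t := rdead rho.
pose new := LogEntry S1 t P pend p1 x ov h.
pose e' i := if (i <= m)%N then e i else new.
have e'_old i : (i <= m)%N -> e' i = e i by rewrite /e' => ->.
have e'_new : e' m.+1 = new by rewrite /e' ltnn.
have rho_pend : rho \in pend by rewrite mem_filter pend_rho.
(* Requests before [rho] are already satisfied, so whatever is pending has a deadline no earlier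
   than [t]. *)
have pendP q : q \in pend ->
    [/\ q \in reqs, t <= rdead q & ~~ satisfied trans q].
  rewrite mem_filter => /andP[/andP[_ nsat] qr]; split => //.
  move: qr; rewrite reqsE mem_cat mem_rcons inE -orbA.
  case/or3P => [/eqP->//|/sat|/rho_rest/ltW//].
  by rewrite /satisfied (negbTE nsat).
have rhoS1 : rnode rho \in S1.
  by apply: (subsetP (serv_sub H)); rewrite inE anc_refl.
have caseS i : (i < m.+1)%N -> i = m \/ (i < m)%N.
  by rewrite ltnS leq_eqVlt => /predU1P.
exists m.+1, e'; split.
- split.
  + rewrite -[m.+1]addn1 iotaD map_cat /= add0n e'_new cats1 (trace_trans T).
    congr rcons; apply/eq_in_map => i; rewrite mem_iota add0n => /andP[_ im].
    by rewrite e'_old.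
  + by rewrite e'_old // (trace_set0 T).
  + by rewrite e'_old // (trace_price0 T).
  + by move=> v; rewrite e'_old // (trace_over0 T).
  + by rewrite e'_old // (trace_time0 T).
  + move=> i /caseS[->|im]; first by rewrite e'_new e'_old.
    by rewrite !e'_old ?(trace_time T) // ltnW.
  + move=> i /caseS[->|im]; first by rewrite e'_new e'_old // pE.
    by rewrite !e'_old ?(ltnW im) //; apply: trace_spec T _ im.
  + move=> i q /caseS[->|im] qr.
      rewrite e'_new /= => qt; rewrite /satisfied has_rcons negb_or.
      by case/andP => _ nsat; rewrite mem_filter /pending qt nsat.
    rewrite e'_old // => qt; rewrite /satisfied has_rcons negb_or.
    by case/andP => _; apply: trace_pend T _ _ im qr qt.
  + move=> i q /caseS[->|im]; first by rewrite e'_new => /pendP[].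
    by rewrite e'_old //; apply: trace_pend_sub T _ _ im.
  + move=> i w /caseS[->|im].
      by rewrite e'_new /= inE => wP; exists rho.
    by rewrite e'_old //; apply: trace_crit T _ _ im.
  + move=> i j q w /andP[ji /caseS[iE|im]]; last first.
      rewrite !e'_old ?(leq_trans ji) ?(ltnW im) //.
      by apply: trace_open T _ _ _ _ _; rewrite ji.
    rewrite iE in ji *; rewrite e'_new e'_old // => /pendP[qr tq nsat].
    (* Entry 0 precedes every arrival. At a real entry [q] was already pending, so the fall of [w]
       considered it; its node was not bought there, or [q] would be satisfied by now. Hence
       [serv_unserved] applies. *)
    case: j ji => [_|j jm] qt wS wq.
      by move: qt; rewrite (trace_time0 T) leNgt t0_lt.
    have qp := trace_pend T jm qr qt nsat.
    have sp := trace_spec T jm.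
    apply: (serv_unserved sp) => //.
      by rewrite !inE wS andbT orbN.
    apply: contraNN nsat => qS.
    apply/hasP; exists (log_set (e j.+1), log_time (e j.+1)).
      rewrite (trace_trans T); apply/mapP.
      by exists j; rewrite // mem_iota.
    rewrite /satisfies qS qt /=; apply: le_trans tq; apply: le_trans (ltW rho_lt).
    by apply: trace_time_le T _; rewrite jm leqnn.
- by rewrite e'_new.
- move=> q; rewrite mem_rcons inE /satisfied has_rcons => /predU1P[->|/sat].
    by rewrite /satisfies /= rhoS1 lexx arr_le.
  by rewrite /satisfied => ->; rewrite orbT.
- by move=> q qr; rewrite e'_new /=; apply: rho_rest.
Qed.

End Run.

(** * Charging the run to a feasible schedule *)

Section Charging.
Variables (R : realFieldType) (V : finType) (r : V) (par : V -> V).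
Variables (c : V -> R) (reqs : seq (request R V)) (t0 : R).
Variables (m : nat) (e : nat -> log_entry R V) (trans sched : seq (service R V)).
Hypothesis tree : is_rooted_tree r par.
Hypothesis c_gt0 : forall v, 0 < c v.
Hypothesis T : trace par c reqs t0 m e trans.
Hypothesis feas : feasible r par reqs sched.

Let S j := log_set (e j).
Let t j := log_time (e j).

(** The lifetime of an item is open on the left and closed on the right, so the lifetimes of the
    items of [v] are disjoint; without a next service it is unbounded. *)
Definition hits (s : service R V) (j : nat) (v : V) : bool :=
  [&& v \in s.1, t j < s.2 &
      [forall k : 'I_m.+1, (j < k)%N && (v \in S k) ==> (s.2 <= t k)]].

Definition good (j : nat) (v : V) : bool := has (fun s => hits s j v) sched.

Definition unserved_during (v : V) (a b : R) : bool :=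
  ~~ has (fun s : service R V => (v \in s.1) && (a < s.2 <= b)) sched.

Definition down (j : nat) (v : V) : bool :=
  [&& ~~ good j v, log_over (e j) v
    & unserved_during v (t j) (log_horizon (e j) v)].

Lemma unserved_during_cat v a b d :
  unserved_during v a b -> unserved_during v b d -> unserved_during v a d.
Proof.
move=> /hasPn ab /hasPn bd; apply/hasPn => s ss.
have := ab s ss; have := bd s ss; case: (v \in s.1) => //=.
by case: (ltP a s.2) => //= _; case: (ltP b s.2).
Qed.

Lemma unserved_during_desc v w a b : anc par v w ->
  unserved_during v a b -> unserved_during w a b.
Proof.
move=> vw /hasPn un; apply/hasPn => s ss; apply: contraNN (un s ss).
by case/andP => ws ->; rewrite (subtree_anc (feas.1 s ss) ws vw).
Qed.

Lemma unserved_during_le v a b d : b <= d ->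
  unserved_during v a d -> unserved_during v a b.
Proof.
move=> bd /hasPn un; apply/hasPn => s ss; apply: contraNN (un s ss).
by case/and3P => -> -> sb; rewrite (le_trans sb).
Qed.

Let last := last_service S.

(** The current item cannot end before service [i.+1], so its lifetime covers the whole interval. *)
Lemma not_good_unserved i w : (i < m)%N -> ~~ good (last i w) w ->
  unserved_during w (t (last i w)) (t i.+1).
Proof.
move=> im /hasPn ng; apply/hasPn => s ss; apply: contraNN (ng s ss).
case/and3P => ws ts st; rewrite /hits ws ts /=.
apply/forallP => k; apply/implyP => /andP[lk wk].
apply: le_trans st _; apply: (trace_time_le T).
rewrite -[(k <= m)%N]ltnS ltn_ord andbT ltnNge; apply/negP => ki.
by have := last_service_max wk ki; rewrite leqNgt -/(last i w) lk.
Qed.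

(** [sched] satisfies [q] with a subtree containing [w]. This cannot happen after the last service
    of [w], so [q] had arrived by then, and [trace_open] shows that the fall of [w] stopped with a
    horizon no later than the deadline of [q]. *)
Lemma not_good_down i w q : (i < m)%N -> q \in log_pend (e i.+1) ->
  anc par w (rnode q) -> unserved_during w (t i.+1) (rdead q) ->
  ~~ good (last i w) w -> down (last i w) w.
Proof.
move=> im qp wq un ng.
have {}un := unserved_during_cat (not_good_unserved im ng) un.
have /hasP[s ss /and3P[qs qa qd]] := feas.2 q (trace_pend_sub T im qp).
have ws := subtree_anc (feas.1 s ss) qs wq.
have arr : rarr q <= t (last i w).
  rewrite leNgt; apply: contraL un => lt; rewrite negbK.
  by apply/hasP; exists s; rewrite // ws qd (lt_le_trans lt).
have wS : w \in S (last i w) by apply: last_service_mem; apply: trace_set0 T.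
have le : (last i w <= i)%N by apply: last_service_le.
have [ov hd] := trace_open T (i := i) (introT andP (conj le im)) qp arr wS wq.
by rewrite /down ng ov (unserved_during_le hd).
Qed.

Lemma sum_unique n (P : pred 'I_n) (b : bool) :
  (forall i j, P i -> P j -> i = j) -> (forall i, P i -> b) ->
  \sum_(i < n) (P i)%:R <= b%:R :> R.
Proof.
move=> uniqP Pb; case: (pickP P) => [i Pi|P0]; last first.
  by rewrite big1 // => i _; rewrite P0.
rewrite (Pb i Pi) (bigD1 i) //= Pi big1 ?addr0 // => j ji.
by case: (boolP (P j)) ji => // Pj; rewrite (uniqP j i) ?eqxx.
Qed.

(** Disjoint lifetimes let each service of [sched] hit at most one item per node it contains. *)
Lemma good_cost_le :
  \sum_(j < m.+1) \sum_(w in S j) (good j w)%:R * c w <= sched_cost c sched.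
Proof.
rewrite /sched_cost /set_cost.
under eq_bigr do rewrite big_mkcond.
under [leRHS]eq_bigr do rewrite big_mkcond.
rewrite exchange_big [leRHS]exchange_big /=; apply: ler_sum => w _.
apply: (@le_trans _ _
  (\sum_(j < m.+1) \sum_(s <- sched) ((w \in S j) && hits s j w)%:R * c w)).
  apply: ler_sum => j _; case: ifP => wS /=; last first.
    by rewrite big1 // => s _; rewrite mul0r.
  rewrite -mulr_suml ler_wpM2r ?(ltW (c_gt0 _)) // /good.
  elim: sched => [|s l IHl] /=; first by rewrite big_nil lexx.
  by rewrite big_cons; case: hits => //=; rewrite ?add0r // lerDl sumr_ge0.
rewrite exchange_big; apply: ler_sum => s _ /=.
rewrite -mulr_suml (_ : (if _ then _ else _) = (w \in s.1)%:R * c w); last first.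
  by case: ifP; rewrite ?mul1r ?mul0r.
rewrite ler_wpM2r ?(ltW (c_gt0 _)) //.
apply: (sum_unique (P := fun j : 'I_m.+1 => (w \in S j) && hits s j w)).
  move=> i j /andP[wi /and3P[_ ti /forallP fi]].
  case/andP=> wj /and3P[_ tj /forallP fj].
  apply: val_inj; case: (ltngtP i j) => // lt.
    by have := fi j; rewrite lt wj /= leNgt tj.
  by have := fj i; rewrite lt wi /= leNgt ti.
by move=> i /andP[_ /and3P[]].
Qed.

Lemma charging_bound :
  sched_cost c trans <= (depth par)%:R * sched_cost c sched.
Proof.
have -> : sched_cost c trans = \sum_(i < m) \sum_(w in S i.+1) c w.
  rewrite /sched_cost (trace_trans T) big_map.
  by rewrite -[m in iota _ m]subn0 -/(index_iota 0 m) big_mkord.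
apply: le_trans (ler_wpM2l (ler0n _ _) good_cost_le).
(* The request behind the investment lies below [w], which lies below [v]; if [sched] avoids [v] up
   to the horizon, it avoids [w] up to the deadline of that request. *)
have edge i v w : (i < m)%N -> log_inv (e i.+1) v w != 0 ->
    ~~ good (last i w) w ->
    unserved_during v (t i.+1) (log_horizon (e i.+1) v) -> down (last i w) w.
  move=> im /(serv_support (trace_spec T im))[_ vw _ [q qp [wq qh]]] ng un.
  apply: not_good_down im qp wq _ ng.
  exact: unserved_during_le qh (unserved_during_desc vw un).
apply: (@cost_le_good _ _ _ S (trace_set0 T) _ (fun j => log_price (e j))
  (fun j => log_crit (e j)) (fun j => log_inv (e j)) _ _ _ _ _ _
  (fun v => #|root_path par v|) _ _ _ _ _ _ good down).
- by move=> v; apply: ltW.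
- by move=> j w; apply: trace_price_ge0 T.
- case=> [|j] w jm wS; first by rewrite (trace_price0 T).
  have sp := trace_spec T jm.
  have [wc|wc] := boolP (w \in log_crit (e j.+1)).
    by rewrite (serv_old sp) // /reset wc.
  by rewrite (serv_served sp) // inE wc.
- move=> i w im wS; have sp := trace_spec T im.
  rewrite (serv_in sp) /investment inE (negbTE wS) andbF /reset.
  by case: ifP => // /(subsetP (serv_sub sp)); rewrite (negbTE wS).
- move=> i w im wS wc.
  rewrite (serv_in (trace_spec T im)) /investment inE wc wS subr0.
  by rewrite /reset (negbTE wc).
- move=> i w im wS wc; have sp := trace_spec T im.
  by rewrite (serv_in sp) /investment inE wc /= (serv_old sp) // subrr.
- exact: root_path_card_gt0.
- exact: root_path_card_le_depth tree.
- by move=> i v w im; apply: serv_inv_ge0 (trace_spec T im) _ _.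
- move=> i v w im /(serv_support (trace_spec T im))[vS vw neq _]; split.
    move: vS; rewrite !inE => /orP[|/andP[]//].
    exact: (subsetP (serv_sub (trace_spec T im))).
  exact: (root_path_card_lt tree vw neq).
- by move=> i v im; apply: serv_out_le (trace_spec T im) _.
- by move=> j v /and3P[].
- by move=> v; rewrite /down (trace_over0 T) andbF.
- by move=> i v im _ /and3P[_ ov _]; apply: serv_out_ov (trace_spec T im) _ ov.
- move=> i v w im /and3P[_ _ un] xn0.
  by case: (boolP (good _ _)) => //= ng; apply: edge im xn0 ng un.
- move=> i v w im xn0 /and3P[ng nd _].
  case: (boolP (good i.+1 v)) => //= ngv.
  have nun : ~~ unserved_during v (t i.+1) (log_horizon (e i.+1) v).
    by apply: contraNN nd; apply: edge im xn0 ng.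
  (* If the item of [v] had no end, any later service of [v] in [sched] would hit it and make it
     good. *)
  rewrite /down (negbTE nun) !andbF /=; apply: contraNneq nun => iE.
  apply/hasPn => s ss; apply: contraNN (hasPn ngv s ss) => /and3P[vs ts _].
  rewrite /hits vs ts /=; apply/forallP => k; apply/implyP => /andP[ik vk].
  have := last_service_max vk (ltn_ord k : (k <= m)%N).
  by rewrite -iE leqNgt ik.
- move=> i w im /(trace_crit T im)[q qp [wq qd]].
  case: (boolP (good _ _)) => //= ng; apply: not_good_down im qp wq _ ng.
  (* The triggering request is due at the service itself, so the interval to avoid is empty. *)
  by apply/hasPn => s _; rewrite qd; case: ltP; rewrite ?andbF.
Qed.

End Charging.

(** * The competitive ratio of Waterfall *)

Theorem mainTheorem6 (R : realFieldType) (V : finType) (r : V) (par : V -> V)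
    (c : V -> R) (enq : {set V} -> seq V) (reqs : seq (request R V)) :
  is_rooted_tree r par ->
  (forall v, 0 < c v) ->
  (forall q, q \in reqs -> rarr q <= rdead q) ->
  uniq [seq rdead q | q <- reqs] ->
  (forall X : {set V}, perm_eq (enq X) (enum X)) ->
  forall sched : seq (service R V),
    feasible r par reqs sched ->
    sched_cost c (waterfall par c enq reqs)
      <= (depth par)%:R * sched_cost c sched.
Proof.
move=> tree c_gt0 arr_le dead_uniq enqP sched feas.
rewrite /waterfall; set sreqs := sort _ reqs.
have memE : sreqs =i reqs by move=> q; rewrite mem_sort.
(* A time for the fictitious entry 0, strictly before all arrivals. *)
have [t0 t0_lt] : exists t0, forall q, q \in sreqs -> t0 < rarr q.
  elim: sreqs {memE} => [|q l [u uP]]; first by exists 0.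
  exists (Num.min u (rarr q - 1)) => q'; rewrite inE gt_min.
  by case/predU1P => [->|/uP->//]; rewrite gtrBl ltr01 orbT.
have sreqs_sorted : sorted (fun q q' : request R V => rdead q < rdead q') sreqs.
  suff : sorted <%O [seq rdead q | q <- sreqs] by rewrite sorted_map.
  rewrite lt_sorted_uniq_le sorted_map.
  rewrite (perm_uniq (perm_map _ (permEl (perm_sort _ reqs)))) dead_uniq.
  by apply: sort_sorted => q q'; apply: le_total.
have arr_le' q : q \in sreqs -> rarr q <= rdead q by rewrite memE; apply: arr_le.
have := @run_trace R V par c enq sreqs t0 c_gt0 enqP t0_lt arr_le' sreqs_sorted
  sreqs [::] (esym (cats0 _)).
case: foldl => [trans p] [m [e [T _ _ _]]] /=.
apply: charging_bound tree c_gt0 T _.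
by split; [exact: feas.1 | move=> q; rewrite memE; apply: feas.2].
Qed.
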